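(* Let $\xi$ be a current with $|\xi|_{\mathcal{M}}<\infty$ and, for every $N\in\mathbb{N}$, let $\gamma^N=(\gamma^{i,N})_{1\le i\le N}$ be a symmetric (exchangeable) family of random $C^1([0,1],\mathbb{R}^d)$ curves, with empirical current $\xi^N=\frac1N\sum_{i=1}^N\gamma^{i,N}$. Suppose that for every $\theta\in C_b(\mathbb{R}^d,\mathbb{R}^d)$ there is $C$ such that $|\gamma^{i,N}(\theta)|\le C$ $\mathbb{P}$-a.s. uniformly in $i,N$, and that $\lim_{N\to\infty}\mathbb{E}[|\xi^N(\theta)-\xi(\theta)|]=0$. Then for every fixed $r\in\mathbb{N}$ and every $(\theta_1,\dots,\theta_r)\in C_b(\mathbb{R}^d,\mathbb{R}^d)^r$, $$\lim_{N\to\infty}\mathbb{E}\big[(\gamma^{1,N}\otimes\cdots\otimes\gamma^{r,N})(\theta_1,\dots,\theta_r)\big]=\prod_{i=1}^r\xi(\theta_i).$$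
   Context: A current is a continuous linear functional on $C_b(\mathbb{R}^d,\mathbb{R}^d)$ (bounded continuous vector fields with sup norm), with $|\xi|_{\mathcal{M}}=\sup_{\|\theta\|_\infty\le1}|\xi(\theta)|$. A $C^1$ curve $\gamma:[0,1]\to\mathbb{R}^d$ is identified with the current $\gamma(\theta)=\int_0^1\langle\theta(\gamma(\sigma)),\partial_\sigma\gamma(\sigma)\rangle d\sigma$. Tensor product: $(\gamma_1\otimes\cdots\otimes\gamma_r)(\theta_1,\dots,\theta_r)=\prod_i\gamma_i(\theta_i)$. A random curve is a measurable map from a probability space $(\Omega,\mathcal{F},\mathbb{P})$ to $C([0,1];\mathbb{R}^d)$ with its Borel $\sigma$-algebra; a family of random curves is symmetric (exchangeable) if its joint law is invariant under permutations of the indices. *)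

(* Defs.v *)
From HB Require Import structures.
From mathcomp Require Import all_boot all_order all_algebra fingroup perm.
From mathcomp Require Import all_classical all_reals all_analysis.
Set Implicit Arguments. Unset Strict Implicit. Unset Printing Implicit Defensive.
Import Order.TTheory GRing.Theory Num.Theory.
Import numFieldNormedType.Exports.
Local Open Scope classical_set_scope.
Local Open Scope ring_scope.

Section Defs.
Variables (R : realType) (dim : nat).

Notation pt := 'rV[R]_dim.

Definition inner (u v : pt) : R := \sum_(j < dim) u ord0 j * v ord0 j.

Definition is_Cb (theta : pt -> pt) : Prop :=
  continuous theta /\ exists M : R, forall x, `|theta x| <= M.

(* A current: a continuous linear functional on C_b(R^dim,R^dim) (sup norm);
   |xi|_M < oo is the existence of a finite M with |xi theta| <= M ||theta||_oo. *)
Definition is_current (xi : (pt -> pt) -> R) : Prop :=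
  (forall (a : R) (t1 t2 : pt -> pt), is_Cb t1 -> is_Cb t2 ->
      xi (fun x => a *: t1 x + t2 x) = a * xi t1 + xi t2) /\
  (forall (t : pt -> pt), is_Cb t -> forall eps : R, 0 < eps ->
      exists delta : R, 0 < delta /\ forall t' : pt -> pt, is_Cb t' ->
        (forall x, `|t' x - t x| <= delta) -> `|xi t' - xi t| <= eps).

Definition finite_mass (xi : (pt -> pt) -> R) : Prop :=
  exists M : R, forall (t : pt -> pt) (c : R), is_Cb t ->
    (forall x, `|t x| <= c) -> `|xi t| <= M * c.

(* A C^1 curve, represented by a function R -> R^dim which is C^1 on R
   (only its restriction to [0,1] matters). *)
Definition is_C1_curve (g : R -> pt) : Prop :=
  (forall t : R, derivable g t 1) /\ continuous (fun t => 'D_1 g t).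

Definition curve_current (g : R -> pt) (theta : pt -> pt) : R :=
  Rintegral (@lebesgue_measure R) `[0%R, 1%R]
    (fun s => inner (theta (g s)) ('D_1 g s)).

Definition empirical_current (N : nat) (gs : nat -> R -> pt) (theta : pt -> pt) : R :=
  N%:R^-1 * \sum_(i < N) curve_current (gs i) theta.

(* Cylinder (= Borel, C([0,1]) being separable) sigma-algebra on N-tuples of
   curves, generated by the evaluations X |-> (X i t)_j, t in [0,1]. *)
Definition cyl_generators (N : nat) : set (set ('I_N -> R -> pt)) :=
  [set A | exists (i : 'I_N) (t : R) (j : 'I_dim) (B : set R),
     [/\ (0 <= t <= 1)%R, measurable B &
         A = (fun X : 'I_N -> R -> pt => X i t ord0 j) @^-1` B]].

Definition cyl_sigma (N : nat) : set (set ('I_N -> R -> pt)) :=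
  <<s @cyl_generators N >>.

End Defs.

Definition is_random_curve (d : measure_display) (T : measurableType d)
  (R : realType) (dim : nat) (g : T -> R -> 'rV[R]_dim) : Prop :=
  forall t : R, (0 <= t <= 1)%R -> forall j : 'I_dim,
    measurable_fun setT (fun w => g w t ord0 j).

Definition exchangeable (d : measure_display) (T : measurableType d)
  (R : realType) (P : probability T R) (dim N : nat)
  (g : 'I_N -> T -> R -> 'rV[R]_dim) : Prop :=
  forall (s : {perm 'I_N}) (A : set ('I_N -> R -> 'rV[R]_dim)),
    cyl_sigma A ->
    P ((fun w i => g i w) @^-1` A) = P ((fun w i => g (s i) w) @^-1` A).

(* Main.v *)
(** For [r <= i < N], exchangeability under the transposition of [r] and [i]
    shows that [E[(\prod_(k < r) gamma^k(theta_k)) gamma^i(theta_r)]] does not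
    depend on [i]. Averaging over all [i < N] therefore replaces the last factor
    of [E[\prod_(k <= r) gamma^k(theta_k)]] by the empirical current
    [xi^N(theta_r)], up to the [r] indices [i < r], which cost O(1/N) since
    everything is bounded.  L^1 convergence then replaces [xi^N(theta_r)] by the
    constant [xi(theta_r)], and one concludes by induction on [r].

    Exchangeability only concerns the sigma-algebra generated by the
    evaluations, so [curve_current] is first written, on C^1 curves, as a limit of
    Riemann-Stieltjes sums, each of which depends on finitely many
    evaluations. *)

Require Import Defs.
From HB Require Import structures.
From mathcomp Require Import all_boot all_order all_algebra fingroup perm.
From mathcomp Require Import all_classical all_reals all_analysis.
From mathcomp Require Import measurable_realfun ring lra.
Import Order.TTheory GRing.Theory Num.Theory.
Import numFieldNormedType.Exports.
Local Open Scope classical_set_scope.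
Local Open Scope ring_scope.

Set Implicit Arguments.
Unset Strict Implicit.
Unset Printing Implicit Defensive.

(** * Riemann-Stieltjes sums converge to the current of a C^1 curve *)

Section calculus.
Context {R : realType}.

(** Heine-Cantor, from compactness in its near-covering form: around each point the radius given by
    continuity is halved, so that every small enough [d] works on a whole neighbourhood. Continuity
    on all of [R] lets [y] leave the segment. *)
Lemma segment_unif_continuous (V : normedModType R) (f : R -> V) (a b e : R) :
  continuous f -> 0 < e ->
  exists2 d, 0 < d & forall x y, x \in `[a, b] -> `|x - y| < d ->
    `|f x - f y| < e.
Proof.
move=> cf e0.
have /compact_near_coveringP := @segment_compact R a b.
move=> /(_ R 0^'+ (fun d x => forall y, `|x - y| < d -> `|f x - f y| < e) _) H.
have : \forall d \near 0^'+, `[a, b]%classic `<=`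
    (fun x => forall y, `|x - y| < d -> `|f x - f y| < e).
  apply: H => x _.
  have /cvgrPdist_lt/(_ (e / 2)) := cf x.
  rewrite divr_gt0// => /(_ isT) /nbhs_ballP[r/= r0 rf].
  have r20 : 0 < r / 2 by rewrite divr_gt0.
  exists (ball x (r / 2), [set d | d < r / 2]) => /=.
    split; first exact: nbhsx_ballx.
    exact: nbhs_right_lt.
  move=> [x' d] [/= xx' dr] y x'y.
  rewrite -(subrKA (f x)) (le_lt_trans (ler_normD _ _))// [ltRHS]splitr ltrD//.
    rewrite distrC; apply: rf; apply: le_ball xx'.
    by rewrite ler_pdivrMr// ler_peMr ?ltW// ltr1n.
  apply: rf; rewrite /ball/= -(subrKA x') (le_lt_trans (ler_normD _ _))//.
  by rewrite [ltRHS]splitr ltrD// (lt_trans x'y).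
move=> Hd.
near (0 : R)^'+ => d.
exists d; first by near: d; exact: nbhs_right_gt.
move=> x y xab xy.
by have : `[a, b]%classic `<=`
    (fun x => forall y, `|x - y| < d -> `|f x - f y| < e); [near: d|apply].
Unshelve. all: by end_near. Qed.

(** The primitive is the integral from [a]. Its two-sided derivative is obtained only strictly
    inside the segment, so the lemma is meant for a segment larger than the one of interest. *)
Lemma segment_primitive (f : R -> R) (a b : R) : continuous f ->
  exists F : R -> R, forall x, a < x < b -> is_derive x (1 : R) F (f x).
Proof.
move=> cf; exists (fun x => \int[lebesgue_measure]_(t in `[a, x]) f t).
move=> x /andP[ax xb].
have intf : lebesgue_measure.-integrable `[a, b] (EFin \o f).
  apply: continuous_compact_integrable; first exact: segment_compact.
  exact: continuous_subspaceT.
have [dF F'] := continuous_FTC1 xb intf ax (cf x).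
by apply: DeriveDef; [exact: dF|rewrite -derive1E; exact: F'].
Qed.

Lemma Rintegral_primitive (f F : R -> R) (a b : R) : a < b ->
  continuous f -> (forall x, a <= x <= b -> is_derive x (1 : R) F (f x)) ->
  \int[lebesgue_measure]_(t in `[a, b]) f t = F b - F a.
Proof.
move=> ab cf dF; rewrite /Rintegral (@continuous_FTC2 _ f F)//.
- exact: continuous_subspaceT.
- have cF x : a <= x <= b -> {for x, continuous F}.
    by move=> /dF/@ex_derive; move/derivable1_diffP/differentiable_continuous.
  split.
  + move=> x; rewrite in_itv/= => /andP[ax xb].
    have h : is_derive x (1 : R) F (f x) by apply: dF; rewrite !ltW.
    exact: ex_derive.
  + by apply: cvg_at_right_filter; apply: cF; rewrite lexx ltW.
  + by apply: cvg_at_left_filter; apply: cF; rewrite lexx ltW.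
- move=> x; rewrite in_itv/= => /andP[ax xb].
  have h : is_derive x (1 : R) F (f x) by apply: dF; rewrite !ltW.
  by rewrite derive1E derive_val.
Qed.

Variable dim : nat.
Notation pt := 'rV[R]_dim.
Implicit Types (u v : pt) (g : R -> pt) (theta : pt -> pt).

Lemma coord_le_norm u j : `|u ord0 j| <= `|u|.
Proof.
by rewrite [leRHS]/Num.Def.normr/= mx_normrE; exact: (le_bigmax _ _ (ord0, j)).
Qed.

Lemma innerBl u1 u2 v : inner (u1 - u2) v = inner u1 v - inner u2 v.
Proof.
by rewrite /inner -sumrB; apply: eq_bigr => j _; rewrite !mxE mulrBl.
Qed.

Lemma innerBr u v1 v2 : inner u (v1 - v2) = inner u v1 - inner u v2.
Proof.
by rewrite /inner -sumrB; apply: eq_bigr => j _; rewrite !mxE mulrBr.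
Qed.

Lemma norm_inner_le u v : `|inner u v| <= dim%:R * (`|u| * `|v|).
Proof.
rewrite /inner (le_trans (ler_norm_sum _ _ _))//.
have -> : dim%:R * (`|u| * `|v|) = \sum_(j < dim) (`|u| * `|v|).
  by rewrite sumr_const card_ord mulr_natl.
apply: ler_sum => j _.
by rewrite normrM ler_pM// coord_le_norm.
Qed.

Lemma continuous_inner (f h : R -> pt) : continuous f -> continuous h ->
  continuous (fun t => inner (f t) (h t)).
Proof.
move=> cf ch; apply: continuous_big; first exact: add_continuous.
move=> j _ t; apply: cvgM.
  by apply: (@continuous_comp _ _ _ f (fun M : pt => M ord0 j));
    [exact: cf | exact: coord_continuous].
by apply: (@continuous_comp _ _ _ h (fun M : pt => M ord0 j));
  [exact: ch | exact: coord_continuous].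
Qed.

Lemma is_derive_inner_curve u g t : derivable g t 1 ->
  is_derive t (1 : R) (fun s => inner u (g s)) (inner u ('D_1 g t)).
Proof.
move=> dg.
have dj j : is_derive t (1 : R) (fun s => g s ord0 j) ('D_1 g t ord0 j).
  rewrite derive_mx// mxE; apply: DeriveDef => //.
  by move/derivable_mxP : dg; exact.
rewrite (_ : (fun s => _) =
    \sum_(j < dim) (u ord0 j \*: (fun s => g s ord0 j : R^o))).
  have := @is_derive_sum _ _ R^o _ _ _ _ _ (fun j =>
    @is_deriveZ _ _ R^o _ (u ord0 j) _ _ _ (dj j)).
  exact.
by apply/funext => s; rewrite /inner fct_sumE.
Qed.

Definition riemann_stieltjes (n : nat) theta g : R :=
  \sum_(k < n) inner (theta (g (k%:R / n%:R)))
                     (g (k.+1%:R / n%:R) - g (k%:R / n%:R)).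

Lemma derivable_continuous g : (forall t, derivable g t 1) -> continuous g.
Proof.
by move=> dg t; apply: differentiable_continuous; exact/derivable1_diffP.
Qed.

(** With [F] a primitive of the integrand, the error on a cell [[a, b]] is the increment of the
    scalar function [F s - inner (theta (g a)) (g s)]. The mean value theorem turns it into [inner
    (theta (g c) - theta (g a)) ('D_1 g c) * (b - a)], which is small by uniform continuity of
    [theta \o g] and boundedness of the velocity. *)
Lemma cvg_riemann_stieltjes theta g : continuous theta -> is_C1_curve g ->
  riemann_stieltjes n theta g @[n --> \oo] --> curve_current g theta.
Proof.
move=> ct [dg cg'].
have cg := derivable_continuous dg.
have ctg : continuous (theta \o g).
  by move=> t; apply: continuous_comp; [exact: cg|exact: ct].
pose f s := inner (theta (g s)) ('D_1 g s).
have cf : continuous f by exact: (@continuous_inner (theta \o g)).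
(* The margin around [[0, 1]] makes [F] differentiable at both endpoints. *)
have [F dF] := segment_primitive (-1) 2 cf.
have dF01 (x : R) : 0 <= x <= 1 -> is_derive x (1 : R) F (f x).
  by move=> x01; apply: dF; lra.
have -> : curve_current g theta = F 1 - F 0.
  by rewrite /curve_current (Rintegral_primitive ltr01 cf dF01).
have [B B0 Bg'] : exists2 B : R, 0 < B &
    forall s, 0 <= s <= 1 -> `|'D_1 g s| <= B.
  have /compact_bounded[M [_ HM]] : compact ((fun s => 'D_1 g s) @` `[0, 1]).
    apply: continuous_compact; last exact: segment_compact.
    exact: continuous_subspaceT.
  exists (`|M| + 1); first by rewrite ltr_pwDr.
  move=> s s01; apply: (HM (`|M| + 1)).
    by rewrite (le_lt_trans (ler_norm _))// ltrDl.
  by exists s => //=; rewrite in_itv.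
apply/cvgrPdist_le => e e0.
(* [dim%:R * B] is the constant lost in bounding [inner]; adding 1 keeps [K] positive even when
   [dim] is 0. *)
pose K := dim%:R * B + 1.
have K0 : 0 < K by rewrite /K ltr_wpDl// mulr_ge0// ltW.
have [d d0 Hd] := segment_unif_continuous 0 1 ctg (divr_gt0 e0 K0).
near=> n.
have n0 : (0 < n)%N by near: n; exists 1%N.
have n0R : 0 < n%:R :> R by rewrite ltr0n.
have nd : n%:R^-1 < d.
  rewrite invf_plt ?posrE//; near: n.
  exact: nbhs_infty_gtr.
(* Telescoping reduces the claim to an error of at most [e / n] on each of the [n] cells. *)
have -> : F 1 - F 0 = \sum_(k < n) (F (k.+1%:R / n%:R) - F (k%:R / n%:R)).
  rewrite -(big_mkord xpredT (fun k => F (k.+1%:R / n%:R) - F (k%:R / n%:R))).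
  by rewrite telescope_sumr// mul0r divff// gt_eqF.
rewrite /riemann_stieltjes -sumrB (le_trans (ler_norm_sum _ _ _))//.
have -> : e = \sum_(k < n) (e / n%:R).
  by rewrite sumr_const card_ord -[RHS]mulr_natr divfK// gt_eqF.
apply: ler_sum => k _.
set a := k%:R / n%:R; set b := k.+1%:R / n%:R.
have ba : b - a = n%:R^-1 by rewrite /a /b -mulrBl -natrB// subSnn mul1r.
have a0 : 0 <= a by rewrite /a divr_ge0.
have b1 : b <= 1 by rewrite /b ler_pdivrMr// mul1r ler_nat.
have ab : a < b by rewrite -subr_gt0 ba invr_gt0.
pose Phi s := F s - inner (theta (g a)) (g s).
pose dPhi s := f s - inner (theta (g a)) ('D_1 g s).
have Phi' s : a <= s <= b -> is_derive s (1 : R) Phi (dPhi s).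
  move=> sab; apply: is_deriveB; first by apply: dF01; lra.
  exact: is_derive_inner_curve.
have [c cab Phic] : exists2 c, c \in `]a, b[%R &
    Phi b - Phi a = dPhi c * (b - a).
  apply: MVT => //.
    by move=> s; rewrite in_itv/= => /andP[s1 s2]; apply: Phi'; rewrite !ltW.
  apply: derivable_within_continuous => s; rewrite in_itv/= => /Phi'.
  by move=> /@ex_derive.
have -> : F b - F a - inner (theta (g a)) (g b - g a) = Phi b - Phi a.
  by rewrite innerBr /Phi; ring.
rewrite Phic ba normrM [X in _ * X]gtr0_norm ?invr_gt0//.
rewrite ler_pM2r ?invr_gt0// /dPhi /f -innerBl.
move: cab; rewrite in_itv/= => /andP[ac cb].
rewrite (le_trans (norm_inner_le _ _))//.
have h1 : `|theta (g c) - theta (g a)| <= e / K.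
  apply/ltW/Hd; first by rewrite in_itv/=; lra.
  by rewrite gtr0_norm ?subr_gt0//; lra.
have h2 : `|'D_1 g c| <= B by apply: Bg'; lra.
apply: (@le_trans _ _ (dim%:R * ((e / K) * B))).
  by rewrite ler_wpM2l// ler_pM.
rewrite [leLHS](_ : _ = e * ((dim%:R * B) / K)); last by ring.
by rewrite ler_piMr ?ltW// ltr_pdivrMr// mul1r /K ltrDl.
Unshelve. all: by end_near. Qed.

End calculus.

(** * Measurability of the current of a random curve *)

Section measurability.
Context {R : realType} {dim : nat}.
Notation pt := 'rV[R]_dim.

(** An open set is a countable union of balls with rational centre and radius [n.+1%:R^-1]. Balls of
    the sup norm are boxes, so each preimage is a finite intersection of conditions on single
    coordinates. *)
Lemma measurable_preimage_open_rV d (D : measurableType d) (h : D -> pt)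
    (U : set pt) :
  (forall j, measurable_fun setT (fun w => h w ord0 j)) -> open U ->
  measurable (h @^-1` U).
Proof.
move=> mh oU.
pose c (q : 'rV[rat]_dim) : pt := map_mx ratr q.
pose box (qn : 'rV[rat]_dim * nat) : set D :=
  [set w | ball (c qn.1) qn.2.+1%:R^-1 `<=` U /\
           forall j, ball (c qn.1 ord0 j) qn.2.+1%:R^-1 (h w ord0 j)].
have -> : h @^-1` U = \bigcup_qn box qn.
  apply/seteqP; split => [w Uw|w [[q n] _ [/= qU qw]]]; last first.
    by apply: qU; split => // i j; rewrite (ord1 i).
  have /nbhs_ballP[r/= r0 rU] := open_nbhs_nbhs (conj oU Uw).
  near \oo => n.
  (* Half of [r], since going from [h w] to a point of the box passes through the rational
     centre. *)
  have nr : n.+1%:R^-1 < r / 2.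
    near: n; exact: near_infty_natSinv_lt (PosNum (divr_gt0 r0 (ltr0Sn _ 1))).
  have n0 : 0 < n.+1%:R^-1 :> R by rewrite invr_gt0.
  have nq (j : 'I_dim) :
      exists q : rat, ball (ratr q : R) n.+1%:R^-1 (h w ord0 j).
    have [x [xb [q _ qx]]] :
        ball (h w ord0 j) n.+1%:R^-1 `&` range ratr !=set0.
      apply: dense_rat; last exact: ball_open.
      by exists (h w ord0 j); exact: ballxx.
    by exists q; apply: ball_sym; rewrite qx.
  have [q qw] := choice nq.
  have hq j : ball (c (\row_j q j) ord0 j) n.+1%:R^-1 (h w ord0 j).
    by rewrite !mxE; exact: qw.
  exists (\row_j q j, n) => //; split => //= y qy.
  apply: rU; apply: (@ball_split _ _ (c (\row_j q j))).
    apply: (le_ball (ltW nr)).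
    by split => // i j; rewrite (ord1 i); exact/ball_sym/hq.
  exact: (le_ball (ltW nr)).
apply: countable_bigcupT_measurable; first exact: countableP.
move=> [q n]; rewrite /box/=.
(* The inclusion in [U] does not involve [w]: when it fails the box is empty. *)
have [qU|qU] := pselect (ball (c q) n.+1%:R^-1 `<=` U); last first.
  by rewrite (_ : [set _ | _] = set0)// -subset0 => w [].
rewrite (_ : [set _ | _] =
    \bigcap_(j in [set: 'I_dim])
      ((fun w => h w ord0 j) @^-1` ball (c q ord0 j) n.+1%:R^-1)); last first.
  apply/seteqP; split => [w [_ hw] j _|w hw]; first exact: hw.
  by split => // j; exact: hw.
apply: fin_bigcap_measurable; first exact: finite_finset.
move=> j _; rewrite -[X in measurable X]setTI.
by apply: mh => //; exact: measurable_ball.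
Unshelve. all: by end_near. Qed.

Lemma measurable_continuous_rV d (D : measurableType d) (h : D -> pt)
    (phi : pt -> R) :
  (forall j, measurable_fun setT (fun w => h w ord0 j)) -> continuous phi ->
  measurable_fun setT (phi \o h).
Proof.
move=> mh cphi; apply: (measurability _ (RGenOInfty.measurableE R)).
move=> _ [_ [x ->] <-]; rewrite setTI comp_preimage.
apply: measurable_preimage_open_rV => //.
by move/continuousP : cphi; apply; exact: interval_open.
Qed.

Lemma measurable_riemann_stieltjes d (D : measurableType d) (g : D -> R -> pt)
    (theta : pt -> pt) n : is_random_curve g -> continuous theta ->
  measurable_fun setT (fun w => riemann_stieltjes n theta (g w)).
Proof.
move=> mg ct; apply: measurable_sum => k; apply: measurable_sum => j.
have n0 : (0 < n%:R :> R) by rewrite ltr0n (leq_ltn_trans _ (ltn_ord k)).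
have k01 : 0 <= (k%:R / n%:R : R) <= 1.
  by rewrite divr_ge0//= ler_pdivrMr// mul1r ler_nat ltnW.
have k101 : 0 <= (k.+1%:R / n%:R : R) <= 1.
  by rewrite divr_ge0//= ler_pdivrMr// mul1r ler_nat.
apply: measurable_funM.
  apply: (@measurable_continuous_rV _ _ (fun w => g w (k%:R / n%:R))
    (fun x => theta x ord0 j)) => [j'|x]; first exact: mg.
  apply: (@continuous_comp _ _ _ theta (fun M : pt => M ord0 j)).
    exact: ct.
  exact: coord_continuous.
under eq_fun do rewrite !mxE.
by apply: measurable_funB; exact: mg.
Qed.

(* Agrees with [curve_current] on C^1 curves, but unlike it is measurable on
   the space of all curves. *)
Definition riemann_stieltjes_limit (theta : pt -> pt) (g : R -> pt) : R :=
  fine (limn_esup (fun n => (riemann_stieltjes n theta g)%:E)).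

Lemma riemann_stieltjes_limitE theta g : continuous theta -> is_C1_curve g ->
  riemann_stieltjes_limit theta g = curve_current g theta.
Proof.
move=> ct cg; rewrite /riemann_stieltjes_limit.
have /cvg_limn_einf_sup[_ ->//] : (riemann_stieltjes n theta g)%:E
    @[n --> \oo] --> (curve_current g theta)%:E.
by apply: cvg_EFin; [exact: nearW|exact: cvg_riemann_stieltjes].
Qed.

Lemma measurable_riemann_stieltjes_limit d (D : measurableType d)
    (g : D -> R -> pt) (theta : pt -> pt) :
  is_random_curve g -> continuous theta ->
  measurable_fun setT (fun w => riemann_stieltjes_limit theta (g w)).
Proof.
move=> mg ct.
apply: (@measurableT_comp _ _ _ _ _ _ fine).
  exact: fine_measurable.
apply: measurable_fun_limn_esup => n.
by apply/measurable_EFinP; exact: measurable_riemann_stieltjes.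
Qed.

Lemma measurable_curve_current d (D : measurableType d) (g : D -> R -> pt)
    (theta : pt -> pt) : is_random_curve g ->
  (forall w, is_C1_curve (g w)) -> continuous theta ->
  measurable_fun setT (fun w => curve_current (g w) theta).
Proof.
move=> mg cg ct.
rewrite (_ : (fun w => _) = fun w => riemann_stieltjes_limit theta (g w)).
  exact: measurable_riemann_stieltjes_limit.
by apply/funext => w; rewrite riemann_stieltjes_limitE.
Qed.

End measurability.

(** * From invariance of the law to equality of expectations *)

Section exchangeability.
Context d (T : measurableType d) (R : realType) (P : probability T R).

(** By change of variables, both sides integrate the same function on [R] against the laws of [X]
    and [Y], which coincide. *)
Lemma eq_law_integral (X Y : T -> R) :
  P.-integrable setT (EFin \o X) -> P.-integrable setT (EFin \o Y) ->
  (forall B, measurable B -> P (X @^-1` B) = P (Y @^-1` B)) ->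
  (\int[P]_w (X w)%:E = \int[P]_w (Y w)%:E)%E.
Proof.
move=> iX iY XY.
have mX : measurable_fun setT X by apply/measurable_EFinP/(measurable_int P iX).
have mY : measurable_fun setT Y by apply/measurable_EFinP/(measurable_int P iY).
pose X' : {mfun T >-> R} :=
  HB.pack X (isMeasurableFun.Build _ _ _ _ _ mX).
pose Y' : {mfun T >-> R} :=
  HB.pack Y (isMeasurableFun.Build _ _ _ _ _ mY).
have := @integral_distribution _ _ _ _ _ P X' EFin.
move=> /(_ (@EFin_measurable R setT) iX) /= <-.
have := @integral_distribution _ _ _ _ _ P Y' EFin.
move=> /(_ (@EFin_measurable R setT) iY) /= <-.
by apply: eq_measure_integral => A mA _; exact: XY.
Qed.

Context {dim : nat}.
Notation pt := 'rV[R]_dim.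

(** The type of [G] puts the cylinder sigma-algebra on tuples of curves, so preimages of Borel sets
    under [G] are events to which exchangeability applies. *)
Lemma exchangeable_integral N (g : 'I_N -> T -> R -> pt) (s : {perm 'I_N})
    (G : g_sigma_algebraType (@cyl_generators R dim N) -> R) :
  exchangeable P g ->
  measurable_fun setT G ->
  P.-integrable setT (fun w => (G (fun i => g i w))%:E) ->
  P.-integrable setT (fun w => (G (fun i => g (s i) w))%:E) ->
  (\int[P]_w (G (fun i => g i w))%:E = \int[P]_w (G (fun i => g (s i) w))%:E)%E.
Proof.
move=> exg mG i1 i2.
apply: (@eq_law_integral (fun w => G (fun i => g i w))
  (fun w => G (fun i => g (s i) w))) => // B mB.
by apply: (exg s (G @^-1` B)); have := mG measurableT B mB; rewrite setTI.
Qed.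

End exchangeability.

(** * Calculus of almost surely bounded random variables *)

Section ae_bounded.
Context d (T : measurableType d) (R : realType) (P : probability T R).
Implicit Types (f g : T -> R) (C D : R).

(** Bundling the sign of [C] and measurability with the bound makes the notion stable under products
    and sufficient for integrability. *)
Definition ae_bounded C f := [/\ 0 <= C, measurable_fun setT f &
  {ae P, forall w, `|f w| <= C}].

Lemma ae_bounded_integral_norm C f : ae_bounded C f ->
  (\int[P]_w `|(f w)%:E| <= C%:E)%E.
Proof.
move=> [C0 mf fC].
rewrite -[leRHS]mule1 -(probability_setT P).
apply: (@integral_le_bound _ _ _ P setT (EFin \o f)) => //.
  exact/measurable_EFinP.
by apply: filterS fC => w /= fw _; rewrite lee_fin.
Qed.

Lemma ae_bounded_integrable C f : ae_bounded C f ->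
  P.-integrable setT (EFin \o f).
Proof.
move=> /[dup] /ae_bounded_integral_norm fC [_ mf _].
apply/integrableP; split; first exact/measurable_EFinP.
exact: le_lt_trans fC (ltry _).
Qed.

Lemma ae_bounded_norm_Rintegral C f : ae_bounded C f ->
  `|\int[P]_w f w| <= C.
Proof.
move=> fC; rewrite -lee_fin EFin_normr_Rintegral//; last first.
  exact: ae_bounded_integrable fC.
apply: le_trans (ae_bounded_integral_norm fC).
apply: le_abse_integral => //; apply/measurable_EFinP.
by case: fC.
Qed.

Lemma ae_bounded_cst C : ae_bounded `|C| (fun=> C).
Proof. by split => //; exact: nearW. Qed.

Lemma ae_boundedM C D f g : ae_bounded C f -> ae_bounded D g ->
  ae_bounded (C * D) (fun w => f w * g w).
Proof.
move=> [C0 mf fC] [D0 mg gD]; split; first exact: mulr_ge0.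
  exact: measurable_funM.
by apply: filterS2 fC gD => w fw gw; rewrite normrM ler_pM.
Qed.

Lemma ae_boundedD C D f g : ae_bounded C f -> ae_bounded D g ->
  ae_bounded (C + D) (fun w => f w + g w).
Proof.
move=> [C0 mf fC] [D0 mg gD]; split; first exact: addr_ge0.
  exact: measurable_funD.
by apply: filterS2 fC gD => w fw gw; rewrite (le_trans (ler_normD _ _))// lerD.
Qed.

Lemma ae_bounded_prod n (C : nat -> R) (f : nat -> T -> R) :
  (forall k, (k < n)%N -> ae_bounded (C k) (f k)) ->
  ae_bounded (\prod_(k < n) C k) (fun w => \prod_(k < n) f k w).
Proof.
elim: n => [|n ih] fC.
  rewrite (_ : (fun w => _) = fun=> 1); last first.
    by apply/funext => w; rewrite big_ord0.
  by rewrite big_ord0 -[X in ae_bounded X]normr1; exact: ae_bounded_cst.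
rewrite (_ : (fun w => _) = fun w => \prod_(k < n) f k w * f n w); last first.
  by apply/funext => w; rewrite big_ord_recr.
rewrite big_ord_recr/=; apply: ae_boundedM; last exact: fC.
by apply: ih => k kn; apply: fC; rewrite ltnS ltnW.
Qed.

Lemma ae_bounded_sum n C (f : nat -> T -> R) : 0 <= C ->
  (forall k, (k < n)%N -> ae_bounded C (f k)) ->
  ae_bounded (n%:R * C) (fun w => \sum_(k < n) f k w).
Proof.
move=> C0; elim: n => [|n ih] fC.
  rewrite (_ : (fun w => _) = fun=> 0); last first.
    by apply/funext => w; rewrite big_ord0.
  by rewrite mul0r -[X in ae_bounded X](normr0 R); exact: ae_bounded_cst.
rewrite (_ : (fun w => _) = fun w => \sum_(k < n) f k w + f n w); last first.
  by apply/funext => w; rewrite big_ord_recr.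
rewrite -natr1 mulrDl mul1r; apply: ae_boundedD; last exact: fC.
by apply: ih => k kn; apply: fC; rewrite ltnS ltnW.
Qed.

Lemma Rintegral_sum_ae_bounded n C (f : nat -> T -> R) : 0 <= C ->
  (forall k, (k < n)%N -> ae_bounded C (f k)) ->
  \int[P]_w (\sum_(k < n) f k w) = \sum_(k < n) \int[P]_w f k w.
Proof.
move=> C0; elim: n => [|n ih] fC.
  under eq_Rintegral do rewrite big_ord0.
  by rewrite big_ord0 Rintegral_cst// mul0r.
under eq_Rintegral do rewrite big_ord_recr/=.
have fCn k : (k < n)%N -> ae_bounded C (f k).
  by move=> kn; apply: fC; rewrite ltnS ltnW.
rewrite RintegralD//.
- by rewrite big_ord_recr/= ih.
- exact: ae_bounded_integrable (ae_bounded_sum C0 fCn).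
- exact: ae_bounded_integrable (fC n (ltnSn n)).
Qed.

End ae_bounded.

(** * Asymptotic factorization for bounded real arrays *)

Section factorization.
Context d (T : measurableType d) (R : realType) (P : probability T R).
Variables (X : nat -> nat -> nat -> T -> R) (x C : nat -> R).

(** [X k N i] stands for the [i]-th curve of the [N]-th family tested against the [k]-th field, and
    [x k] for the limit current on that field. In [tensor], the [k]-th field is paired with the
    [k]-th curve. Exchangeability enters only through [tensorE]. *)
Definition mean k N w := N%:R^-1 * \sum_(i < N) X k N i w.
Definition tensor r N w := \prod_(k < r) X k N k w.

Hypothesis C0 : forall k, 0 <= C k.
Hypothesis bX : forall k N i, (i < N)%N -> ae_bounded P (C k) (X k N i).
Hypothesis cvg_mean : forall k,
  \int[P]_w `|mean k N w - x k| @[N --> \oo] --> (0 : R).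
Hypothesis tensorE : forall r N i, (r <= i < N)%N ->
  \int[P]_w (tensor r N w * X r N i w) = \int[P]_w tensor r.+1 N w.

Lemma ae_bounded_tensor r N : (r <= N)%N ->
  ae_bounded P (\prod_(k < r) C k) (tensor r N).
Proof.
move=> rN; apply: (@ae_bounded_prod _ _ _ _ r C (fun k => X k N k)) => k kr.
exact/bX/(leq_trans kr).
Qed.

Lemma ae_bounded_mean k N :
  ae_bounded P (`|N%:R^-1| * (N%:R * C k)) (mean k N).
Proof.
apply: ae_boundedM; first exact: ae_bounded_cst.
by apply: ae_bounded_sum => // i iN; exact: bX.
Qed.

(** After expanding the mean, the terms with [r <= i] agree with the first integral by [tensorE].
    Each of the [r] others costs at most twice the product of the bounds, and the average divides by
    [N]. *)
Lemma tensor_mean_dist r N : (r < N)%N ->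
  `|\int[P]_w tensor r.+1 N w - \int[P]_w (tensor r N w * mean r N w)| <=
  (2 * r%:R * \prod_(k < r.+1) C k) * N%:R^-1.
Proof.
move=> rN; have N0 : 0 < N%:R :> R by rewrite ltr0n (leq_ltn_trans _ rN).
pose K := \prod_(k < r.+1) C k.
have K0 : 0 <= K by apply: prodr_ge0 => k _.
pose Y i w := tensor r N w * X r N i w.
have bY i : (i < N)%N -> ae_bounded P K (Y i).
  move=> iN; rewrite /K big_ord_recr/=; apply: ae_boundedM; last exact: bX.
  exact/ae_bounded_tensor/ltnW.
have -> : \int[P]_w (tensor r N w * mean r N w) =
    N%:R^-1 * \sum_(i < N) \int[P]_w Y i w.
  rewrite -(Rintegral_sum_ae_bounded K0 bY) -RintegralZl//; last first.
    exact: ae_bounded_integrable (ae_bounded_sum K0 bY).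
  apply: eq_Rintegral => w _; rewrite /mean mulrCA; congr (_ * _).
  by rewrite mulr_sumr.
set a := \int[P]_w tensor r.+1 N w.
(* Written as an average of [N] copies, [a] can be compared with the mean term by term. *)
have -> : a = N%:R^-1 * \sum_(i < N) a.
  by rewrite sumr_const card_ord -[X in _ * X]mulr_natl mulKf// gt_eqF.
rewrite -mulrBr -sumrB normrM ger0_norm ?invr_ge0// mulrC.
rewrite ler_pM2r ?invr_gt0// (le_trans (ler_norm_sum _ _ _))//.
apply: (@le_trans _ _ (\sum_(i < N | (i < r)%N) 2 * K)); last first.
  rewrite -(big_ord_widen N (fun=> 2 * K) (ltnW rN)).
  by rewrite sumr_const card_ord -[leLHS]mulr_natl mulrCA mulrA.
rewrite [leRHS]big_mkcond/=; apply: ler_sum => i _.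
case: ltnP => ir; last by rewrite /Y tensorE ?ir ?ltn_ord// subrr normr0.
rewrite (le_trans (ler_normB _ _))// mulr_natl mulr2n lerD//.
  by apply: ae_bounded_norm_Rintegral; exact: ae_bounded_tensor.
by apply: ae_bounded_norm_Rintegral; exact: bY.
Qed.

(** As [x r] is deterministic, the difference is the integral of
    [tensor r N w * (mean r N w - x r)], and the almost sure bound on the tensor factors out. *)
Lemma tensor_mean_limit_dist r N : (r <= N)%N ->
  `|\int[P]_w (tensor r N w * mean r N w) - x r * \int[P]_w tensor r N w| <=
  \prod_(k < r) C k * \int[P]_w `|mean r N w - x r|.
Proof.
move=> rN; have bt := ae_bounded_tensor rN.
have it := ae_bounded_integrable bt.
have itm := ae_bounded_integrable (ae_boundedM bt (ae_bounded_mean r N)).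
have bmx := ae_boundedD (ae_bounded_mean r N) (ae_bounded_cst P (- x r)).
have itmx := ae_bounded_integrable (ae_boundedM bt bmx).
have imx := integrable_norm (ae_bounded_integrable bmx).
have -> : \int[P]_w (tensor r N w * mean r N w) - x r * \int[P]_w tensor r N w =
    \int[P]_w (tensor r N w * (mean r N w - x r)).
  rewrite -RintegralZl// -RintegralB//; last first.
    exact: ae_bounded_integrable (ae_boundedM (ae_bounded_cst P (x r)) bt).
  by apply: eq_Rintegral => w _; rewrite mulrBr [x r * _]mulrC.
rewrite (le_trans (le_normr_Rintegral _ _))// -RintegralZl//.
(* The almost everywhere comparison is made between extended real integrals, hence the finiteness
   goals. *)
rewrite -lee_fin /Rintegral !fineK; last 2 first.
- apply: integrable_fin_num => //.
  exact: (@integrableZl _ _ _ P _ measurableT (\prod_(k < r) C k) _ imx).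
- exact: integrable_fin_num (integrable_norm itmx).
have [_ mt tC] := bt; have [_ mmx _] := bmx.
apply: ae_ge0_le_integral => //.
- apply/measurable_EFinP; apply: measurableT_comp => //.
  exact: measurable_funM.
- by move=> w _; rewrite lee_fin mulr_ge0// prodr_ge0.
- apply/measurable_EFinP; apply: measurable_funM => //.
  exact: measurableT_comp.
by apply: filterS tC => w tw _; rewrite lee_fin normrM ler_wpM2r.
Qed.

Lemma cvg_Rintegral_tensor r :
  \int[P]_w tensor r N w @[N --> \oo] --> \prod_(k < r) x k.
Proof.
elim: r => [|r ih].
  rewrite big_ord0 (_ : (fun N => _) = fun=> 1); first exact: cvg_cst.
  apply/funext => N; under eq_Rintegral do rewrite /tensor big_ord0.
  rewrite Rintegral_cst// mul1r -[RHS]/(fine 1%E); congr fine.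
  exact: probability_setT.
rewrite big_ord_recr/= mulrC.
pose t r N := \int[P]_w tensor r N w.
(* The last summand converges by induction; the difference is squeezed by [b], the sum of the two
   preceding estimates. *)
rewrite (_ : (fun N => _) =
    fun N => (t r.+1 N - x r * t r N) + x r * t r N); last first.
  by apply/funext => N; rewrite subrK.
rewrite -[X in _ --> X]add0r; apply: cvgD; last first.
  by apply: cvgM; [exact: cvg_cst|exact: ih].
apply: norm_cvg0.
pose b N := (2 * r%:R * \prod_(k < r.+1) C k) * N%:R^-1 +
  \prod_(k < r) C k * \int[P]_w `|mean r N w - x r|.
apply: (@squeeze_cvgr _ _ _ _ (cst 0) b).
- near=> N; rewrite normr_ge0/=.
  have rN : (r < N)%N by near: N; exact: nbhs_infty_gt.
  rewrite -(subrKA (\int[P]_w (tensor r N w * mean r N w))).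
  rewrite (le_trans (ler_normD _ _))// lerD//.
    exact: tensor_mean_dist.
  exact/tensor_mean_limit_dist/ltnW.
- exact: cvg_cst.
- rewrite -[X in _ --> X]addr0; apply: cvgD.
    rewrite -[X in _ --> X](mulr0 (2 * r%:R * \prod_(k < r.+1) C k)).
    apply: cvgM; first exact: cvg_cst.
    apply/gtr0_cvgV0; last exact: cvgr_idn.
    by near=> N; rewrite ltr0n; near: N; exact: nbhs_infty_gt.
  rewrite -[X in _ --> X](mulr0 (\prod_(k < r) C k)).
  by apply: cvgM; [exact: cvg_cst|exact: cvg_mean].
Unshelve. all: by end_near. Qed.

End factorization.

(** * Application to exchangeable random curves *)

Lemma is_Cb0 (R : realType) (dim : nat) :
  is_Cb (fun=> 0 : 'rV[R]_dim).
Proof.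
by split; [exact: cst_continuous|exists 0 => x; rewrite normr0].
Qed.

(** Viewing the coordinate maps as random curves on path space transfers the measurability lemmas to
    functionals of tuples of curves. *)
Lemma is_random_curve_coord (R : realType) (dim N : nat) (i : 'I_N) :
  is_random_curve
    (fun Y : g_sigma_algebraType (@cyl_generators R dim N) => Y i).
Proof.
move=> t t01 j _ B mB; rewrite setTI.
by apply: sub_sigma_algebra; exists i, t, j, B.
Qed.

Section currents.
Context d (T : measurableType d) (R : realType) (P : probability T R).
Context (dim N : nat) (gamma : nat -> T -> R -> 'rV[R]_dim).
Variables (theta : nat -> 'rV[R]_dim -> 'rV[R]_dim) (C : nat -> R).
Hypothesis ct : forall k, continuous (theta k).
Hypothesis cg : forall i w, (i < N)%N -> is_C1_curve (gamma i w).
Hypothesis exg : exchangeable P (fun i : 'I_N => gamma i).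
Hypothesis bg : forall k i, (i < N)%N ->
  ae_bounded P (C k) (fun w => curve_current (gamma i w) (theta k)).

(** The transposition of [r] and [i] fixes every index below [r], so it changes only the curve in
    the last factor. *)
Lemma exchangeable_tensor r i : (r <= i < N)%N ->
  \int[P]_w (\prod_(k < r) curve_current (gamma k w) (theta k) *
             curve_current (gamma i w) (theta r)) =
  \int[P]_w (\prod_(k < r.+1) curve_current (gamma k w) (theta k)).
Proof.
move=> /andP[ri iN]; have rN := leq_ltn_trans ri iN.
pose i0 := Ordinal iN; pose r0 := Ordinal rN.
(* [riemann_stieltjes_limit] replaces [curve_current] because [G] must be measurable on all tuples
   of curves, including those that are not C^1. *)
pose G (Y : g_sigma_algebraType (@cyl_generators R dim N)) : R :=
  \prod_(k < r) riemann_stieltjes_limit (theta k)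
                  (Y (widen_ord (ltnW rN) k)) *
  riemann_stieltjes_limit (theta r) (Y r0).
have mG : measurable_fun setT G.
  apply: measurable_funM.
    apply: measurable_prod => k _.
    apply: measurable_riemann_stieltjes_limit; last exact: ct.
    exact: is_random_curve_coord.
  apply: measurable_riemann_stieltjes_limit; last exact: ct.
  exact: is_random_curve_coord.
have GE w : G (fun i : 'I_N => gamma i w) =
    \prod_(k < r.+1) curve_current (gamma k w) (theta k).
  rewrite big_ord_recr /G/=; congr (_ * _).
    apply: eq_bigr => k _; rewrite riemann_stieltjes_limitE//.
    by apply: cg; exact: (ltn_trans (ltn_ord k) rN).
  by rewrite riemann_stieltjes_limitE//; exact: cg.
have GsE w : G (fun i : 'I_N => gamma (tperm i0 r0 i) w) =
    \prod_(k < r) curve_current (gamma k w) (theta k) *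
    curve_current (gamma i w) (theta r).
  rewrite /G tpermR; congr (_ * _).
    apply: eq_bigr => k _; rewrite tpermD/=.
    - rewrite riemann_stieltjes_limitE//.
      by apply: cg; exact: (ltn_trans (ltn_ord k) rN).
    - by rewrite -val_eqE/= gtn_eqF// (leq_trans _ ri).
    - by rewrite -val_eqE/= gtn_eqF.
  by rewrite riemann_stieltjes_limitE//; exact: cg.
have bprod n : (n <= N)%N -> ae_bounded P (\prod_(k < n) C k)
    (fun w => \prod_(k < n) curve_current (gamma k w) (theta k)).
  move=> nN; apply: (@ae_bounded_prod _ _ _ _ n C
    (fun k w => curve_current (gamma k w) (theta k))) => k kn.
  exact/bg/(leq_trans kn).
congr fine.
transitivity (\int[P]_w (G (fun i : 'I_N => gamma (tperm i0 r0 i) w))%:E)%E.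
  by apply: eq_integral => w _; rewrite GsE.
rewrite -(@exchangeable_integral _ _ _ P _ _ (fun i : 'I_N => gamma i)
  (tperm i0 r0) G exg mG).
- by apply: eq_integral => w _; rewrite GE.
- apply: eq_integrable (ae_bounded_integrable (bprod _ rN)) => // w _.
  by rewrite /= GE.
- apply: eq_integrable (ae_bounded_integrable
    (ae_boundedM (bprod _ (ltnW rN)) (bg r iN))) => // w _.
  by rewrite /= GsE.
Qed.

End currents.

Theorem theorem6p4 (d : measure_display) (T : measurableType d) (R : realType)
  (P : probability T R) (dim : nat)
  (xi : ('rV[R]_dim -> 'rV[R]_dim) -> R)
  (gamma : nat -> nat -> T -> R -> 'rV[R]_dim) :
  is_current xi ->
  finite_mass xi ->
  (forall N i w, (i < N)%N -> is_C1_curve (gamma N i w)) ->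
  (forall N i, (i < N)%N -> is_random_curve (gamma N i)) ->
  (forall N, exchangeable P (fun i : 'I_N => gamma N i)) ->
  (forall theta, is_Cb theta ->
     exists C : R, forall N i, (i < N)%N ->
       {ae P, forall w, `|curve_current (gamma N i w) theta| <= C}) ->
  (forall theta, is_Cb theta ->
     (fun N => (\int[P]_w
        (`|empirical_current N (fun i => gamma N i w) theta - xi theta|)%:E)%E)
       @ \oo --> 0%E) ->
  forall (r : nat) (theta : 'I_r -> 'rV[R]_dim -> 'rV[R]_dim),
    (forall k, is_Cb (theta k)) ->
    (fun N => (\int[P]_w
       (\prod_(k < r) curve_current (gamma N k w) (theta k))%:E)%E)
      @ \oo --> (\prod_(k < r) xi (theta k))%:E.
Proof.
move=> _ _ cg mg exg bg cvgx r theta Cbt.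
(* The induction on the number of factors needs fields indexed by [nat]; the zero field fills the
   indices from [r] on. *)
pose th (k : nat) := if insub k is Some k' then theta k' else fun=> 0.
have Cbth k : is_Cb (th k).
  by rewrite /th; case: insubP => [k' _ _|_]; [exact: Cbt|exact: is_Cb0].
have thE (k : 'I_r) : th k = theta k by rewrite /th valK.
have [C HC] := choice (fun k => bg _ (Cbth k)).
pose X k N i w := curve_current (gamma N i w) (th k).
(* The constants are given without a sign, hence the absolute value. *)
have bX k N i : (i < N)%N -> ae_bounded P `|C k| (X k N i).
  move=> iN; split => //.
    by apply: measurable_curve_current; [exact: mg|move=> w; exact: cg|
      exact: (Cbth k).1].
  by apply: filterS (HC k N i iN) => w /le_trans; apply; exact: ler_norm.
have cvg_mean k :
    \int[P]_w `|mean X k N w - xi (th k)| @[N --> \oo] --> (0 : R).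
  by apply: fine_cvg; exact: cvgx.
have tensorE s N i : (s <= i < N)%N ->
    \int[P]_w (tensor X s N w * X s N i w) = \int[P]_w tensor X s.+1 N w.
  move=> siN.
  apply: (@exchangeable_tensor _ _ _ _ _ N (gamma N) th (fun k => `|C k|)) => //.
  - by move=> k; exact: (Cbth k).1.
  - by move=> j w jN; exact: cg.
  - by move=> k j jN; exact: bX.
have := @cvg_Rintegral_tensor _ _ _ _ X (xi \o th) _
  (fun k => normr_ge0 (C k)) bX cvg_mean tensorE r.
rewrite (eq_bigr (fun k => xi (theta k))); last by move=> k _; rewrite /= thE.
move=> h.
have {}h : (\int[P]_w tensor X r N w)%:E @[N --> \oo] -->
    (\prod_(k < r) xi (theta k))%:E.
  by apply: cvg_EFin; [exact: nearW|exact: h].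
(* The real and extended real integrals are identified only for [r <= N], where all the curves
   involved belong to the family and integrability is known. *)
apply: cvg_trans h; apply: near_eq_cvg; near=> N.
have rN : (r <= N)%N by near: N; exact: nbhs_infty_ge.
have it : P.-integrable setT (EFin \o tensor X r N).
  apply: (@ae_bounded_integrable _ _ _ _ (\prod_(k < r) `|C k|)).
  exact: (@ae_bounded_tensor _ _ _ P X (fun k => `|C k|)).
rewrite /= /Rintegral fineK; last exact: integrable_fin_num it.
by apply: eq_integral => w _; congr EFin; apply: eq_bigr => k _; rewrite /X thE.
Unshelve. all: by end_near. Qed.
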